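(* Let $f\in\mathcal{S}_L$ with $\arg\min f\neq\varnothing$, and fix $x^\star\in\arg\min f$. Let $x_0,y_0\in\mathbb{R}^d$ and let $P_0\in\mathbb{R}^{d\times d}$ be diagonal with $P_0\succ0$. Generate $(x_k,y_k,P_k)$ by $$\frac{x_{k+1}-x_k}{\alpha_k}=y_k-x_{k+1}-\beta_kP_k^{-1}\nabla f(x_k),\qquad \frac{P_{k+1}-P_k}{\widetilde\alpha_k}=-P_k+\gamma_kP_{k+1}^{-1}G_{k+1}^2,$$ $$\frac{y_{k+1}-y_k}{\widetilde\alpha_k}=-P_{k+1}^{-1}\nabla f(x_{k+1}),\qquad G_{k+1}^2=\mathrm{diag}\big((\partial_1 f(x_{k+1}))^2,\dots,(\partial_d f(x_{k+1}))^2\big),$$ where $P_{k+1}$ is the positive definite diagonal solution of its equation, the method being terminated at the first index $\ell$ with $\nabla f(x_\ell)=0$, if there is one. Put $\eta_k:=\alpha_k\beta_k$ and $x_k^+:=x_k-\eta_kP_k^{-1}\nabla f(x_k)$ (so $x_\ell^+=x_\ell$ at a terminal index $\ell$). Assume there exists $R>0$ with $$\sup_{k\ge0}\|y_k-x^\star\|_\infty\le R .$$ For each $k$ with $\nabla f(x_k)\ne0$ let the parameters be chosen such that $$\eta_k=\bar\eta(P_k^{-1},\nabla f(x_k)),\qquad 0<\alpha_k\le\sqrt{\eta_k/2},\qquad \widetilde\alpha_k=\frac{\alpha_k}{1+\alpha_k},\qquad \gamma_k=\frac{\widetilde\alpha_k}{R^2}.$$ Assume further that for all $k\ge0$ (for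 which $\eta_{k+1}$ is defined, i.e. $x_{k+1}$ is generated and $\nabla f(x_{k+1})\neq0$) $$2\widetilde\alpha_k^2=\frac{2\alpha_k^2}{(1+\alpha_k)^2}\le\eta_{k+1}.$$ Then for all $k\ge0$ (for which $x_{k+1}$ is generated) $$\mathcal{E}_{k+1}\le\mathcal{E}_0\prod_{j=0}^{k}\frac{1}{1+\alpha_j},\qquad\text{where}\quad \mathcal{E}_k:=f(x_k^+)-f(x^\star)+\tfrac12\|y_k-x^\star\|_{P_k}^2 .$$
   Context: $\mathcal{S}_L$ ($L>0$) is the set of differentiable convex functions $f:\mathbb{R}^d\to\mathbb{R}$ whose gradient is $L$-Lipschitz in the Euclidean norm. For a symmetric matrix $A$, $\|x\|_A^2:=\langle Ax,x\rangle$; $A\succ0$ means symmetric positive definite. $\|\cdot\|_\infty$ is the maximum norm. For $P\succ0$ and $g\ne0$, $$\bar\eta(P^{-1},g):=\frac1L\,\frac{\|g\|_{P^{-1}}^2}{\|g\|_{P^{-2}}^2}.$$ The parameters satisfy $\alpha_k,\beta_k,\gamma_k>0$; since $\eta_k=\alpha_k\beta_k$, the choice of $\eta_k$ and $\alpha_k$ determines $\beta_k=\eta_k/\alpha_k$. The update of $P$ is implicit; its positive definite diagonal solution is $P_{k+1}=\frac{1-\widetilde\alpha_k}{2}P_k+\frac12\sqrt{(1-\widetilde\alpha_k)^2P_k^2+4\widetilde\alpha_k\gamma_kG_{k+1}^2}$ (entrywise square root on the diagonal). If $\nabla f(x_\ell)=0$, then $x_\ell$ is a minimizer and the method stops there;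 if there is no such $\ell$, the sequences are infinite. *)

(* Defs.v *)
From HB Require Import structures.
From mathcomp Require Import all_boot all_order all_algebra.
From mathcomp Require Import all_classical all_reals all_analysis.

Set Implicit Arguments.
Unset Strict Implicit.
Unset Printing Implicit Defensive.

Import Order.TTheory GRing.Theory Num.Theory.
Import numFieldNormedType.Exports.

Local Open Scope classical_set_scope.
Local Open Scope ring_scope.

Definition dotp (R : realType) (d : nat) (u v : 'cV[R]_d) : R :=
  (u^T *m v) 0 0.

(* The library norm `|u| on 'cV[R]_d is the maximum norm, hence a separate
   Euclidean norm. *)
Definition enorm (R : realType) (d : nat) (u : 'cV[R]_d) : R :=
  Num.sqrt (dotp u u).

Definition wnorm2 (R : realType) (d : nat) (A : 'M[R]_d) (u : 'cV[R]_d) : R :=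
  dotp (A *m u) u.

Definition posdefmx (R : realType) (d : nat) (A : 'M[R]_d) : Prop :=
  A^T = A /\ forall u : 'cV[R]_d, u != 0 -> 0 < wnorm2 A u.

Definition grad (R : realType) (d : nat) (f : 'cV[R]_d -> R) (u : 'cV[R]_d)
    : 'cV[R]_d :=
  \col_i 'D_(delta_mx i 0) f u.

Definition smooth_convex (R : realType) (d : nat) (L : R) (f : 'cV[R]_d -> R)
    : Prop :=
  [/\ forall u, differentiable f u,
      convex_function (setT : set (convex_lmodType 'cV[R]_d)) f &
      forall u v, enorm (grad f u - grad f v) <= L * enorm (u - v)].

Definition argmin (R : realType) (d : nat) (f : 'cV[R]_d -> R)
    : set 'cV[R]_d :=
  [set u | forall v, f u <= f v].

Definition gradsq_mx (R : realType) (d : nat) (f : 'cV[R]_d -> R)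
    (u : 'cV[R]_d) : 'M[R]_d :=
  diag_mx (\row_i (grad f u i 0) ^+ 2).

(* Q stands for the inverse of the preconditioner, so Q ^+ 2 is P^{-2}. *)
Definition eta_bar (R : realType) (d : nat) (L : R) (Q : 'M[R]_d)
    (g : 'cV[R]_d) : R :=
  L^-1 * (wnorm2 Q g / wnorm2 (Q ^+ 2) g).

(* The method stops at the first index with a vanishing gradient. Iterates are
   total sequences; only the entries of index k with [generated f x k] belong to
   the method, and the later entries are arbitrary. The step from k to k.+1 is
   carried out exactly when [generated f x k.+1]. *)
Definition generated (R : realType) (d : nat) (f : 'cV[R]_d -> R)
    (x : nat -> 'cV[R]_d) (k : nat) : Prop :=
  forall j, (j < k)%N -> grad f (x j) != 0.

(* At a terminal index the gradient vanishes, so there xplus is x k whatever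
   the value of eta k is. *)
Definition xplus (R : realType) (d : nat) (f : 'cV[R]_d -> R)
    (eta : nat -> R) (x : nat -> 'cV[R]_d) (P : nat -> 'M[R]_d) (k : nat)
    : 'cV[R]_d :=
  x k - eta k *: (invmx (P k) *m grad f (x k)).

Definition energy (R : realType) (d : nat) (f : 'cV[R]_d -> R)
    (xs : 'cV[R]_d) (eta : nat -> R) (x y : nat -> 'cV[R]_d)
    (P : nat -> 'M[R]_d) (k : nat) : R :=
  f (xplus f eta x P k) - f xs + 2^-1 * wnorm2 (P k) (y k - xs).

(* Main.v *)
Require Import Defs.
From HB Require Import structures.
From mathcomp Require Import all_boot all_order all_algebra.
From mathcomp Require Import all_classical all_reals all_analysis.
From mathcomp Require Import ring lra.

Set Implicit Arguments.
Unset Strict Implicit.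
Unset Printing Implicit Defensive.

Import Order.TTheory GRing.Theory Num.Theory.
Import numFieldNormedType.Exports.

Local Open Scope classical_set_scope.
Local Open Scope ring_scope.

(** Write t = a / (1 + a) for the damped step, g' for the new gradient and
    N = |g'|^2 in the norm of P'^-1, where P' is the new preconditioner. The
    theorem is the one-step decay E' <= (1 - t) E of the energy, where
    1 - t = 1 / (1 + a), iterated; three facts are added up to get it.

    - By the descent lemma, a gradient step preconditioned by Q = P'^-1 with the
      step size [eta_bar] decreases f by at least eta / 2 * N
      ([preconditioned_descent]). The condition 2 t^2 <= eta makes this decrease
      at least t^2 N. At a terminal index N = 0 and nothing is needed.
    - Expanding the square in the y-update and inserting the P-update bounds
      half the new quadratic term, coordinate by coordinate, by the old one
      times 1 - t, plus the cross term - t <g', y - xs>, plus half of two errors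
      ([wnorm2_step]). One error is the squared y-increment, t^2 N. The other
      comes from the gradient term of the P-update, and is at most t^2 N as
      well, since |y - xs| is bounded by r in the maximum norm and
      gamma = t / r^2. Half of their sum is at most the gain t^2 N above.
    - The x-update says that x' is the convex combination (1 - t) x^+ + t y, so
      the cross term equals (1 - t) <g', x^+ - x'> + t <g', xs - x'>, which the
      gradient inequality for f bounds by
      (1 - t) f (x^+) + t f (xs) - f (x'). *)

(** * Inner product and norms *)

Lemma dotpE (R : realType) (d : nat) (u v : 'cV[R]_d) :
  dotp u v = \sum_i u i 0 * v i 0.
Proof. by rewrite /dotp mxE; apply: eq_bigr => i _; rewrite mxE. Qed.

Lemma dotpC (R : realType) (d : nat) (u v : 'cV[R]_d) : dotp u v = dotp v u.
Proof. by rewrite !dotpE; apply: eq_bigr => i _; rewrite mulrC. Qed.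

Lemma dotpDl (R : realType) (d : nat) (u v w : 'cV[R]_d) :
  dotp (u + v) w = dotp u w + dotp v w.
Proof. by rewrite /dotp linearD mulmxDl mxE. Qed.

Lemma dotpZl (R : realType) (d : nat) (c : R) (u v : 'cV[R]_d) :
  dotp (c *: u) v = c * dotp u v.
Proof. by rewrite /dotp linearZ -scalemxAl mxE. Qed.

Lemma dotpNl (R : realType) (d : nat) (u v : 'cV[R]_d) :
  dotp (- u) v = - dotp u v.
Proof. by rewrite -scaleN1r dotpZl mulN1r. Qed.

Lemma dotpDr (R : realType) (d : nat) (u v w : 'cV[R]_d) :
  dotp u (v + w) = dotp u v + dotp u w.
Proof. by rewrite !(dotpC u) dotpDl. Qed.

Lemma dotpZr (R : realType) (d : nat) (c : R) (u v : 'cV[R]_d) :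
  dotp u (c *: v) = c * dotp u v.
Proof. by rewrite !(dotpC u) dotpZl. Qed.

Lemma dotpNr (R : realType) (d : nat) (u v : 'cV[R]_d) :
  dotp u (- v) = - dotp u v.
Proof. by rewrite !(dotpC u) dotpNl. Qed.

Lemma dotpp_ge0 (R : realType) (d : nat) (u : 'cV[R]_d) : 0 <= dotp u u.
Proof. by rewrite dotpE sumr_ge0// => i _; rewrite -expr2 sqr_ge0. Qed.

Lemma enorm_sqr (R : realType) (d : nat) (u : 'cV[R]_d) :
  enorm u ^+ 2 = dotp u u.
Proof. by rewrite sqr_sqrtr// dotpp_ge0. Qed.

Lemma enormZ (R : realType) (d : nat) (c : R) (u : 'cV[R]_d) :
  enorm (c *: u) = `|c| * enorm u.
Proof.
by rewrite /enorm dotpZl dotpZr mulrA -expr2 sqrtrM ?sqr_ge0// sqrtr_sqr.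
Qed.

(** The norm of the library on matrices is the maximum norm. *)
Lemma coord_le_norm (R : realType) (d : nat) (u : 'cV[R]_d) (i : 'I_d) :
  `|u i 0| <= `|u|.
Proof.
rewrite [leRHS]/Num.Def.normr /= mx_normrE.
by apply/bigmax_geP; right => /=; exists (i, 0).
Qed.

(** * Diagonal preconditioners *)

Lemma wnorm2_diag (R : realType) (d : nat) (p : 'rV[R]_d) (u : 'cV[R]_d) :
  wnorm2 (diag_mx p) u = \sum_i p 0 i * u i 0 ^+ 2.
Proof.
rewrite /wnorm2 dotpE; apply: eq_bigr => i _.
by rewrite mul_diag_mx mxE expr2 mulrA.
Qed.

Lemma wnorm2_sqr (R : realType) (d : nat) (Q : 'M[R]_d) (u : 'cV[R]_d) :
  Q^T = Q -> wnorm2 (Q ^+ 2) u = dotp (Q *m u) (Q *m u).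
Proof.
move=> Qsym; rewrite /wnorm2 /dotp expr2 -mulmxE -!mulmxA.
by rewrite trmx_mul Qsym !trmx_mul Qsym !mulmxA.
Qed.

Lemma posdef_diag (R : realType) (d : nat) (A : 'M[R]_d) :
  is_diag_mx A -> posdefmx A ->
  exists2 p : 'rV[R]_d, A = diag_mx p & forall i, 0 < p 0 i.
Proof.
move=> /diag_mxP[p ->] [_ pos]; exists p => // i.
have ei0 : (delta_mx i 0 : 'cV[R]_d) != 0.
  apply/eqP => /matrixP/(_ i 0); rewrite !mxE !eqxx /=.
  by move/eqP; rewrite oner_eq0.
have := pos _ ei0; rewrite wnorm2_diag (bigD1 i)//= big1 ?addr0.
  by rewrite !mxE !eqxx expr1n mulr1.
by move=> j /negPf ji; rewrite !mxE ji/= expr0n mulr0.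
Qed.

Lemma invmx_diag (R : realType) (d : nat) (p : 'rV[R]_d) :
  (forall i, p 0 i != 0) ->
  invmx (diag_mx p) = diag_mx (\row_i (p 0 i)^-1).
Proof.
move=> p_neq0.
have pV : diag_mx p *m diag_mx (\row_i (p 0 i)^-1) = 1%:M.
  rewrite mulmx_diag; apply/matrixP => i j; rewrite !mxE.
  by rewrite divff.
have [pU _] := mulmx1_unit pV.
by rewrite -[RHS](mulKmx pU) pV mulmx1.
Qed.

(** * Convex functions with Lipschitz gradient *)

Lemma derive_grad (R : realType) (d : nat) (f : 'cV[R]_d -> R)
    (u h : 'cV[R]_d) :
  differentiable f u -> 'D_h f u = dotp (grad f u) h.
Proof.
move=> df; rewrite deriveE// {1}[h]matrix_sum_delta raddf_sum dotpE.
apply: eq_bigr => i _; rewrite big_ord1.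
rewrite [LHS]linearZ/= -deriveE//.
by rewrite mxE mulrC.
Qed.

Lemma is_derive_line (R : realType) (d : nat) (f : 'cV[R]_d -> R)
    (u h : 'cV[R]_d) (t : R) :
  differentiable f (u + t *: h) ->
  is_derive t 1 (fun s : R => f (u + s *: h)) (dotp (grad f (u + t *: h)) h).
Proof.
move=> df; have dfh : derivable f (u + t *: h) h by exact: diff_derivable.
(* Both derivatives are limits of the same difference quotient. *)
have quotE : (fun s : R => s^-1 *: (((fun s : R => f (u + s *: h)) \o shift t)
                 (s *: 1) - f (u + t *: h))) =
    (fun s : R => s^-1 *: ((f \o shift (u + t *: h)) (s *: h)
                 - f (u + t *: h))).
  apply/funext => s /=; congr (_ *: (f _ - _)).
  by rewrite [s *: 1]mulr1 scalerDl addrCA.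
split; first by rewrite /derivable quotE.
by rewrite /derive quotE -derive_grad.
Qed.

(** The graph of a convex function lies above its tangents: by convexity the
    difference quotient in the direction v - u is at most f v - f u on ]0, 1],
    and the limit at 0 from the right inherits this bound. *)
Lemma convex_grad_le (R : realType) (d : nat) (f : 'cV[R]_d -> R)
    (u v : 'cV[R]_d) :
  differentiable f u ->
  convex_function (setT : set (convex_lmodType 'cV[R]_d)) f ->
  f u + dotp (grad f u) (v - u) <= f v.
Proof.
move=> df cf; rewrite -derive_grad// addrC -lerBrDr.
have /cvg_dnbhs_at_right dfu : derivable f u (v - u) by exact: diff_derivable.
apply: cvgr_to_le dfu _.
near=> s.
have s_gt0 : 0 < s by [].
have s_le1 : s <= 1 by near: s; exact: nbhs_right_le.
pose t : {i01 R} := Itv01 (ltW s_gt0) s_le1.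
have := cf t v u; rewrite !inE => /(_ I I).
rewrite convRE /= => cvx.
have -> : s *: (v - u) + u = s *: v + (1 - s) *: u.
  by rewrite scalerBr scalerBl scale1r addrAC addrA.
rewrite [_ *: _]mulrC ler_pdivrMr// lerBlDr.
suff -> : (f v - f u) * s + f u = s * f v + (1 - s) * f u by [].
by ring.
Unshelve. all: by end_near. Qed.

(** The descent lemma. The function phi below is, up to the constant f u, the
    gap between the two sides along the segment from u to u + h. Its derivative
    is nonpositive, so that the mean value theorem gives phi 1 <= phi 0. *)
Lemma lipschitz_grad_le (R : realType) (d : nat) (L : R) (f : 'cV[R]_d -> R)
    (u h : 'cV[R]_d) :
  (forall v, differentiable f v) ->
  (forall v w, enorm (grad f v - grad f w) <= L * enorm (v - w)) ->
  0 < L ->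
  f (u + h) <= f u + dotp (grad f u) h + L / 2 * dotp h h.
Proof.
move=> df lip L_gt0.
pose b := dotp (grad f u) h; pose c := L / 2 * dotp h h.
pose phi (s : R) := f (u + s *: h) - (b * s + c * s ^+ 2).
pose dphi (s : R) := dotp (grad f (u + s *: h)) h - (b + c * (2 * s)).
have Dphi (t : R) : is_derive t 1 phi (dphi t).
  apply: is_deriveB; first exact: is_derive_line.
  apply: is_derive_eq.
  by rewrite /GRing.scale/=; ring.
have [|t] := @MVT_segment R phi dphi 0 1 ler01.
  apply: continuous_subspaceT => /= t.
  by apply: differentiable_continuous; apply/derivable1_diffP.
rewrite in_itv/= => /andP[t_ge0 _].
rewrite subr0 mulr1 /phi scale1r scale0r addr0 => phiE.
have dphi_le0 : dphi t <= 0.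
  have [->|t_gt0] := eqVneq t 0.
    by rewrite /dphi scale0r addr0 !mulr0 addr0 subrr.
  have {t_ge0} {}t_gt0 : 0 < t by rewrite lt_neqAle eq_sym t_gt0.
  set w := grad f (u + t *: h) - grad f u.
  have dphiE : dphi t = dotp w h - L * t * dotp h h.
    by rewrite /dphi /w dotpDl dotpNl /b /c; field.
  have w_le : dotp w w <= (L * t) ^+ 2 * dotp h h.
    rewrite -!enorm_sqr -exprMn lerXn2r ?nnegrE ?sqrtr_ge0//.
      by rewrite !mulr_ge0 ?sqrtr_ge0 1?ltW.
    have := lip (u + t *: h) u.
    by rewrite addrAC subrr add0r enormZ gtr0_norm// mulrA.
  (* In place of Cauchy-Schwarz: expanding |w - L t h|^2 >= 0 bounds
     2 L t <w, h> by |w|^2 + (L t)^2 |h|^2 <= 2 (L t)^2 |h|^2. *)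
  clearbody w.
  have := dotpp_ge0 (w - (L * t) *: h).
  rewrite dotpDl !dotpDr !dotpNl !dotpNr !dotpZl !dotpZr opprK (dotpC h w).
  have Lt_gt0 : 0 < L * t by rewrite mulr_gt0.
  rewrite dphiE subr_le0 -(ler_pM2l Lt_gt0).
  by move: w_le; rewrite expr2; nra.
move: phiE dphi_le0; rewrite /b /c !mulr0 !mulr1 expr1n expr0n/= !mulr0.
lra.
Qed.

(** The step size [eta_bar] minimizes the bound of the descent lemma along the
    direction - Q g. If the denominator of [eta_bar] is zero, then so is
    [eta_bar], and both sides are f u; hence Q and the gradient may be
    degenerate. *)
Lemma preconditioned_descent (R : realType) (d : nat) (L : R)
    (f : 'cV[R]_d -> R) (Q : 'M[R]_d) (u : 'cV[R]_d) :
  (forall v, differentiable f v) ->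
  (forall v w, enorm (grad f v - grad f w) <= L * enorm (v - w)) ->
  0 < L -> Q^T = Q ->
  f (u - eta_bar L Q (grad f u) *: (Q *m grad f u)) <=
  f u - eta_bar L Q (grad f u) / 2 * wnorm2 Q (grad f u).
Proof.
move=> df lip L_gt0 Qsym.
set g := grad f u; set e := eta_bar L Q g.
apply: le_trans (lipschitz_grad_le u (- (e *: (Q *m g))) df lip L_gt0) _.
rewrite !dotpNr dotpNl opprK dotpZr dotpZl dotpZr (dotpC _ (Q *m g)).
rewrite -/(wnorm2 Q g) -wnorm2_sqr//.
have Le : L * (e * wnorm2 (Q ^+ 2) g) * e = e * wnorm2 Q g.
  rewrite /e /eta_bar; have [->|B_neq0] := eqVneq (wnorm2 (Q ^+ 2) g) 0.
    by rewrite invr0 !mulr0 !mul0r.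
  by field; rewrite B_neq0 gt_eqF.
by rewrite -/g; nra.
Qed.

(** * Decay of the energy *)

(** Here w stands for y - xs. Of the two terms t^2 |g|^2 in the norm of P'^-1,
    one is the squared increment of w, and the other pays for replacing P' by
    (1 - t) P on w. *)
Lemma wnorm2_step (R : realType) (d : nat) (P P' : 'M[R]_d)
    (g w : 'cV[R]_d) (t c r : R) :
  is_diag_mx P -> is_diag_mx P' -> posdefmx P' ->
  0 < t -> 0 < r -> c = t / r ^+ 2 -> `|w| <= r ->
  t^-1 *: (P' - P) = - P + c *: (invmx P' *m diag_mx (\row_i g i 0 ^+ 2)) ->
  wnorm2 P' (w - t *: (invmx P' *m g)) <=
  (1 - t) * wnorm2 P w - 2 * t * dotp g w + 2 * t ^+ 2 * wnorm2 (invmx P') g.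
Proof.
move=> /diag_mxP[p ->] dP' /(posdef_diag dP')[q -> q_gt0].
move=> t_gt0 r_gt0 cE w_le.
rewrite invmx_diag; last by move=> i; rewrite gt_eqF.
move=> stepE; rewrite !wnorm2_diag dotpE !mulr_sumr -sumrB -big_split/=.
apply: ler_sum => i _.
(* The implicit update of the preconditioner, solved for its left-hand side. *)
have {stepE} qE : q 0 i = (1 - t) * p 0 i + t * c * (g i 0 ^+ 2 / q 0 i).
  move/matrixP: stepE => /(_ i i); rewrite mulmx_diag !mxE eqxx !mulr1n => qE.
  apply: (addIr (- p 0 i)); rewrite -[LHS](mulVKf (lt0r_neq0 t_gt0)) qE.
  by ring.
rewrite mul_diag_mx !mxE.
have q_neq0 : q 0 i != 0 by rewrite gt_eqF.
set W := w i 0; set G := g i 0; set qi := q 0 i in qE q_neq0 *.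
have -> : qi * (W - t * (qi^-1 * G)) ^+ 2 =
    qi * W ^+ 2 - 2 * t * (G * W) + t ^+ 2 * (qi^-1 * G ^+ 2) by field.
have cW : c * W ^+ 2 <= t.
  rewrite cE mulrAC ler_pdivrMr ?exprn_gt0// ler_pM2l//.
  rewrite -[leLHS]real_normK ?num_real//.
  rewrite lerXn2r ?nnegrE ?(ltW r_gt0)//.
  exact: le_trans (coord_le_norm w i) w_le.
have N_ge0 : 0 <= t * (qi^-1 * G ^+ 2).
  apply: mulr_ge0; first exact: ltW.
  by apply: mulr_ge0; rewrite ?sqr_ge0// invr_ge0; exact/ltW/q_gt0.
have -> : qi * W ^+ 2 = (1 - t) * (p 0 i * W ^+ 2) +
    c * W ^+ 2 * (t * (qi^-1 * G ^+ 2)) by rewrite {1}qE -/G; field.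
have := ler_wpM2r N_ge0 cW.
lra.
Qed.

(** One step of the method, with u and u' standing for x^+ at the old and the
    new index, and x for the new iterate. *)
Lemma energy_step (R : realType) (d : nat) (f : 'cV[R]_d -> R)
    (P P' : 'M[R]_d) (xs u u' x y : 'cV[R]_d) (a t c r : R) :
  (forall v, differentiable f v) ->
  convex_function (setT : set (convex_lmodType 'cV[R]_d)) f ->
  is_diag_mx P -> is_diag_mx P' -> posdefmx P' -> 0 < a -> 0 < r ->
  t = a / (1 + a) -> c = t / r ^+ 2 -> `|y - xs| <= r ->
  (1 + a) *: x = u + a *: y ->
  t^-1 *: (P' - P) = - P + c *: (invmx P' *m gradsq_mx f x) ->
  f u' <= f x - t ^+ 2 * wnorm2 (invmx P') (grad f x) ->
  f u' - f xs + 2^-1 * wnorm2 P' (y - t *: (invmx P' *m grad f x) - xs) <=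
  (1 + a)^-1 * (f u - f xs + 2^-1 * wnorm2 P (y - xs)).
Proof.
move=> df cf dP dP' pP' a_gt0 r_gt0 tE cE yr xE PE u'_le.
have a1_gt0 : 0 < 1 + a by rewrite addr_gt0.
have t_gt0 : 0 < t by rewrite tE divr_gt0.
have t1 : (1 + a)^-1 = 1 - t by rewrite tE; field; rewrite gt_eqF.
have t1_ge0 : 0 <= 1 - t by rewrite -t1 invr_ge0 ltW.
have := wnorm2_step dP dP' pP' t_gt0 r_gt0 cE yr PE.
rewrite addrAC; set g := grad f x in u'_le * => W_le.
(* Since x = (1 - t) u + t y. *)
have tyE : t *: (y - xs) = - ((1 - t) *: (u - x) + t *: (xs - x)).
  have -> : u = (1 + a) *: x - a *: y by rewrite xE addrK.
  apply/matrixP => i j; rewrite !mxE -t1 tE; field.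
  by rewrite gt_eqF.
have gyE : t * dotp g (y - xs) =
    - ((1 - t) * dotp g (u - x) + t * dotp g (xs - x)).
  by rewrite -dotpZr tyE dotpNr [dotp g (_ *: _ + _)]dotpDr !dotpZr.
have u_ge := ler_wpM2l t1_ge0 (convex_grad_le u (df x) cf).
have xs_ge := ler_wpM2l (ltW t_gt0) (convex_grad_le xs (df x) cf).
rewrite t1; move: W_le gyE u_ge xs_ge u'_le; rewrite -/g; lra.
Qed.

Theorem theorem4p1 (R : realType) (d : nat) (L : R) (f : 'cV[R]_d -> R)
    (xs : 'cV[R]_d) (x y : nat -> 'cV[R]_d) (P : nat -> 'M[R]_d)
    (alpha beta gamma atilde eta : nat -> R) (r : R)
    (L_gt0 : 0 < L)
    (fS : smooth_convex L f)
    (xs_min : argmin f xs)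
    (P0_diag : is_diag_mx (P 0%N))
    (P0_pos : posdefmx (P 0%N))
    (eta_def : forall k, eta k = alpha k * beta k)
    (params_gt0 : forall k, generated f x k.+1 ->
       [/\ 0 < alpha k, 0 < beta k & 0 < gamma k])
    (x_step : forall k, generated f x k.+1 ->
       (alpha k)^-1 *: (x k.+1 - x k) =
       y k - x k.+1 - beta k *: (invmx (P k) *m grad f (x k)))
    (P_step : forall k, generated f x k.+1 ->
       [/\ is_diag_mx (P k.+1),
           posdefmx (P k.+1) &
           (atilde k)^-1 *: (P k.+1 - P k) =
           - P k + gamma k *: (invmx (P k.+1) *m gradsq_mx f (x k.+1))])
    (y_step : forall k, generated f x k.+1 ->
       (atilde k)^-1 *: (y k.+1 - y k) =
       - (invmx (P k.+1) *m grad f (x k.+1)))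
    (r_gt0 : 0 < r)
    (y_bound : forall k, generated f x k -> `|y k - xs| <= r)
    (params : forall k, generated f x k.+1 ->
       [/\ eta k = eta_bar L (invmx (P k)) (grad f (x k)),
           alpha k <= Num.sqrt (eta k / 2),
           atilde k = alpha k / (1 + alpha k) &
           gamma k = atilde k / r ^+ 2])
    (eta_next : forall k, generated f x k.+1 -> grad f (x k.+1) != 0 ->
       2 * atilde k ^+ 2 <= eta k.+1) :
  forall k, generated f x k.+1 ->
    energy f xs eta x y P k.+1 <=
    energy f xs eta x y P 0 * \prod_(0 <= j < k.+1) (1 + alpha j)^-1.
Proof.
case: fS => df cf lip.
have genW k : generated f x k.+1 -> generated f x k.
  by move=> gen j jk; apply: gen; rewrite ltnS ltnW.
have Pdiag k : generated f x k -> is_diag_mx (P k).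
  by case: k => // k /P_step[].
have step k : generated f x k.+1 ->
    energy f xs eta x y P k.+1 <= (1 + alpha k)^-1 * energy f xs eta x y P k.
  move=> gen; have [a_gt0 _ _] := params_gt0 k gen.
  have [_ _ tE cE] := params k gen; have [dP' pP' PE] := P_step k gen.
  have t_gt0 : 0 < atilde k by rewrite tE divr_gt0// addr_gt0.
  have yE : y k.+1 = y k - atilde k *: (invmx (P k.+1) *m grad f (x k.+1)).
    by rewrite -scalerN -y_step// scalerA divff ?gt_eqF// scale1r addrC subrK.
  have xE : (1 + alpha k) *: x k.+1 = xplus f eta x P k + alpha k *: y k.
    have := congr1 ( *:%R (alpha k)) (x_step k gen).
    rewrite scalerA divff ?gt_eqF// scale1r !scalerBr scalerA -eta_def.
    move=> /(canRL (subrK _)) xE.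
    rewrite scalerDl scale1r [X in X + _]xE /xplus.
    by apply/matrixP => i j; rewrite !mxE; ring.
  rewrite /energy yE.
  apply: (energy_step df cf (Pdiag _ (genW _ gen)) dP' pP' a_gt0 r_gt0 tE cE
    (y_bound _ (genW _ gen)) xE PE).
  have [g0|g_neq0] := eqVneq (grad f (x k.+1)) 0.
    rewrite /xplus g0 mulmx0 scaler0 subr0 /wnorm2 mulmx0.
    by rewrite /dotp mulmx0 mxE mulr0 subr0.
  (* The gradient at k.+1 does not vanish, so that eta k.+1 is prescribed. *)
  have gen' : generated f x k.+2.
    by move=> j; rewrite ltnS leq_eqVlt => /predU1P[->//|]; exact: gen.
  have [eE _ _ _] := params _ gen'.
  have Qsym : (invmx (P k.+1))^T = invmx (P k.+1).
    by rewrite trmx_inv (proj1 pP').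
  have := preconditioned_descent (x k.+1) df lip L_gt0 Qsym.
  rewrite -eE -/(xplus f eta x P k.+1) => /le_trans; apply.
  rewrite lerD2l lerN2 ler_wpM2r//.
    have [q -> q_gt0] := posdef_diag dP' pP'.
    rewrite invmx_diag; last by move=> i; rewrite gt_eqF.
    rewrite wnorm2_diag sumr_ge0// => i _.
    by rewrite mulr_ge0 ?sqr_ge0// mxE invr_ge0 ltW.
  by have := eta_next k gen g_neq0; lra.
elim=> [|k IHk] gen.
  by rewrite big_nat1 mulrC; exact: step.
rewrite big_nat_recr//= mulrA [leRHS]mulrC.
apply: le_trans (step _ gen) _.
have [a_gt0 _ _] := params_gt0 _ gen.
rewrite ler_wpM2l//; first by rewrite invr_ge0 addr_ge0// ltW.
exact/IHk/genW.
Qed.
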